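(* Let $\theta\in\mathcal{P}_{n_0,\ldots,n_m}$ be an ordinary parameter. (1) If $Z$ is a finite set of parametrically smooth points for $\theta$, then $$\dim_{\mathrm{ba.fun}}(\theta,Z)=\operatorname{rank}\mathcal{K}_Z(\theta).$$ (2) $$\dim_{\mathrm{fun}}(\theta)=\sup\{\operatorname{rank}\mathcal{K}_Z(\theta) : Z\subset\mathbb{R}^{n_0}\text{ finite and parametrically smooth for }\theta\}.$$
   Context: An architecture is a tuple $(n_0,\ldots,n_m)$ of positive integers with $m\ge 1$. Let $\sigma$ denote the map applying $t\mapsto\max\{0,t\}$ to each coordinate of a vector in any $\mathbb{R}^n$. Put $D=D(n_0,\ldots,n_m)=\sum_{i=1}^m n_i(n_{i-1}+1)$ and $\mathcal{P}_{n_0,\ldots,n_m}=\mathbb{R}^{D}$ (parameter space). A parameter $\theta\in\mathcal{P}_{n_0,\ldots,n_m}$ is identified with a list of matrices $[A^i]$ of size $n_i\times(n_{i-1}+1)$, $1\le i\le m$, giving affine maps $A^i:\mathbb{R}^{n_{i-1}}\to\mathbb{R}^{n_i}$, $A^i(x)=[A^i][x,1]^T$. The realization map $\rho$ sends $\theta$ to the function $\rho(\theta)=\sigma\circ A^m\circ\cdots\circ\sigma\circ A^1:\mathbb{R}^{n_0}\to\mathbb{R}^{n_m}$; $\rho_k(\theta)$ is its $k$th coordinate function. Let $\mathcal{F}(\theta,x)=\rho(\theta)(x)$. A point $x\in\mathbb{R}^{n_0}$ is parametrically smooth for $\theta$ if $\mathcal{F}:\mathcal{P}_{n_0,\ldots,n_m}\times\mathbb{R}^{n_0}\to\mathbb{R}^{n_m}$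 is $C^\infty$ at $(\theta,x)$ (i.e. on a neighborhood of it). A finite set $Z\subset\mathbb{R}^{n_0}$ is parametrically smooth for $\theta$ if all its points are. A parameter $\theta$ is ordinary if at least one point of $\mathbb{R}^{n_0}$ is parametrically smooth for $\theta$. For a finite ordered set $Z=\{z_1,\ldots,z_N\}\subset\mathbb{R}^{n_0}$, the evaluation map $E_Z:\mathcal{P}_{n_0,\ldots,n_m}\to\mathbb{R}^{N n_m}$ is $E_Z(\theta)=(\rho(\theta)(z_1),\ldots,\rho(\theta)(z_N))$, and $\mathbf{J}E_Z|_\theta$ is its Jacobian matrix with respect to the parameter coordinates at $\theta$. For a finite set $Z$ of parametrically smooth points for an ordinary $\theta$, the batch functional dimension is $\dim_{\mathrm{ba.fun}}(\theta,Z)=\operatorname{rank}\mathbf{J}E_Z|_\theta$. The functional dimension of an ordinary parameter $\theta$ is $$\dim_{\mathrm{fun}}(\theta)=\sup\{\operatorname{rank}\mathbf{J}E_Z|_\theta : Z\subset\mathbb{R}^{n_0}\text{ finite and parametrically smooth for }\theta\}.$$ Neural tangent kernel: for $x,y$ at which the partial derivatives with respect to all parameter coordinates exist, $\mathrm{NTK}(\theta,x,y)$ is the $n_m\times n_m$ matrix with entries $$\mathrm{NTK}(\theta,x,y)_{k,l}=\sum_{i=1}^{D}\frac{\partial\rho_k(\theta)(x)}{\partial\theta_i}\frac{\partial\rho_l(\theta)(y)}{\partial\theta_i}.$$ Batch neural tangent kernel: for $Z=\{z_1,\ldots,z_N\}$ a finite set of parametrically smooth points for $\theta$, $\mathcal{K}_Z(\theta)$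 is the $Nn_m\times Nn_m$ block matrix with $N\times N$ blocks of size $n_m\times n_m$, whose $(i,j)$th block is $\mathrm{NTK}(\theta,z_i,z_j)$. *)

(* Defs.v *)
From HB Require Import structures.
From mathcomp Require Import all_boot all_order all_algebra.
From mathcomp Require Import all_classical all_reals all_analysis.

Set Implicit Arguments.
Unset Strict Implicit.
Unset Printing Implicit Defensive.

Import Order.TTheory GRing.Theory Num.Theory.
Import numFieldNormedType.Exports.

Local Open Scope classical_set_scope.
Local Open Scope ring_scope.

(* A function is C^(k+1) on U when it is differentiable on U and its
   differential is C^k there. As V is finite-dimensional in all uses, a map
   into the space of linear maps V -> W is C^k iff its value at every vector v
   is. *)
Fixpoint Ck_on (R : realType) (V W : normedModType R) (k : nat) (U : set V)
    (f : V -> W) : Prop :=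
  match k with
  | 0 => forall p, U p -> {for p, continuous f}
  | k'.+1 => (forall p, U p -> differentiable f p) /\
             (forall v, Ck_on k' U (fun p => 'd f p v))
  end.

Definition smooth_at (R : realType) (V W : normedModType R) (f : V -> W)
    (p : V) : Prop :=
  exists U : set V, open_nbhs p U /\ forall k, Ck_on k U f.

(* The architecture (n_0, ..., n_m) is given by m and a function n : nat -> nat,
   only the values n 0, ..., n m of which are used. *)
Fixpoint param_dim (n : nat -> nat) (m : nat) : nat :=
  if m is m'.+1 then (param_dim n m' + n m'.+1 * (n m' + 1))%N else 0%N.

Lemma param_dimE (n : nat -> nat) (m : nat) :
  param_dim n m = (\sum_(1 <= i < m.+1) n i * (n i.-1 + 1))%N.
Proof.
elim: m => [|m IHm]; first by rewrite big_geq.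
by rewrite big_nat_recr //= -IHm.
Qed.

Definition relu (R : realType) (d : nat) (x : 'rV[R]_d) : 'rV[R]_d :=
  map_mx (fun t => Num.max 0 t) x.

(* Points of R^d are row vectors; [x, 1]^T is the only place where a column is
   needed. *)
Definition affine (R : realType) (d e : nat) (A : 'M[R]_(e, d + 1))
    (x : 'rV[R]_d) : 'rV[R]_e :=
  (A *m (row_mx x 1%:M)^T)^T.

(* The last n_m * (n_(m-1) + 1) coordinates of a parameter are the entries, row
   by row, of [A^m]; the first ones are the parameter of the truncated
   architecture (n_0, ..., n_(m-1)). *)
Fixpoint realization (R : realType) (n : nat -> nat) (m : nat) :
    'rV[R]_(param_dim n m) -> 'rV[R]_(n 0%N) -> 'rV[R]_(n m) :=
  match m with
  | 0 => fun _ x => x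
  | m'.+1 => fun theta x =>
      relu (affine (vec_mx (rsubmx theta)) (realization (lsubmx theta) x))
  end.

Arguments realization {R} n m theta x.

Section FunctionalDimension.
Variables (R : realType) (n : nat -> nat) (m : nat).
Implicit Types (theta : 'rV[R]_(param_dim n m)) (x y : 'rV[R]_(n 0%N)).

Definition param_smooth theta x : Prop :=
  smooth_at
    (fun p : 'rV[R]_(param_dim n m) * 'rV[R]_(n 0%N) =>
       realization n m p.1 p.2)
    (theta, x).

Definition ordinary theta : Prop := exists x, param_smooth theta x.

(* A finite ordered set of N points is a duplicate-free N-tuple. *)
Definition smooth_batch theta (N : nat) (Z : N.-tuple 'rV[R]_(n 0%N)) : Prop :=
  uniq Z /\ forall z, z \in Z -> param_smooth theta z.

Definition eval_map (N : nat) (Z : N.-tuple 'rV[R]_(n 0%N)) theta :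
    'rV[R]_(\sum_(i < N) n m) :=
  \mxrow_(i < N) realization n m theta (tnth Z i).

(* 'J acts on row vectors by right multiplication; the transpose restores the
   convention in which rows are indexed by the outputs. *)
Definition jacobian_eval theta (N : nat) (Z : N.-tuple 'rV[R]_(n 0%N)) :
    'M[R]_(\sum_(i < N) n m, param_dim n m) :=
  ('J (eval_map Z) theta)^T.

Definition dim_bafun theta (N : nat) (Z : N.-tuple 'rV[R]_(n 0%N)) : nat :=
  \rank (jacobian_eval theta Z).

(* The supremum is taken in the extended reals, so that no boundedness of the
   ranks is presupposed. *)
Definition sup_over_batches theta
    (r : forall N : nat, N.-tuple 'rV[R]_(n 0%N) -> nat) : \bar R :=
  ereal_sup [set d : \bar R | exists (N : nat) (Z : N.-tuple 'rV[R]_(n 0%N)),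
    smooth_batch theta Z /\ d = ((r N Z)%:R)%:E].

Definition dim_fun theta : \bar R :=
  sup_over_batches theta (fun N Z => \rank (jacobian_eval theta Z)).

Definition partial_param theta x (k : 'I_(n m)) (i : 'I_(param_dim n m)) : R :=
  'D_(delta_mx 0 i : 'rV[R]_(param_dim n m))
    (fun t : 'rV[R]_(param_dim n m) => realization n m t x 0 k) theta.

Definition NTK theta x y : 'M[R]_(n m) :=
  \matrix_(k, l) \sum_(i < param_dim n m)
    partial_param theta x k i * partial_param theta y l i.

Definition batch_NTK theta (N : nat) (Z : N.-tuple 'rV[R]_(n 0%N)) :
    'M[R]_(\sum_(i < N) n m) :=
  \mxblock_(i < N, j < N) NTK theta (tnth Z i) (tnth Z j).

End FunctionalDimension.

(* Main.v *)
(** Each row of the Jacobian [J] of the evaluation map lists the partial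
    derivatives of one output coordinate at one point of the batch, so the
    batch neural tangent kernel is the Gram matrix [J J^T]; over the reals
    [u J J^T = 0] forces [|u J|^2 = 0], hence [J J^T] and [J] have the same
    rank. *)
Require Import Defs.
From mathcomp Require Import all_boot all_order all_algebra.
From mathcomp Require Import all_classical all_reals all_analysis.

Import Order.TTheory GRing.Theory Num.Theory.
Import numFieldNormedType.Exports.

Local Open Scope ring_scope.

(** Each diagonal entry of [A *m A^T] is the sum of the squares of a row of [A], and over an ordered
    domain such a sum vanishes only termwise. *)
Lemma mulmx_tr_eq0 (R : realDomainType) (p q : nat) (A : 'M[R]_(p, q)) :
  A *m A^T = 0 -> A = 0.
Proof.
move=> AA0; apply/matrixP => i j; apply/eqP; rewrite mxE -sqrf_eq0.
have sq_ge0 k : true -> 0 <= A i k ^+ 2 by rewrite sqr_ge0.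
have /eqP : \sum_k A i k ^+ 2 = 0.
  move/matrixP: AA0 => /(_ i i); rewrite !mxE => AA0; rewrite -[RHS]AA0.
  by apply: eq_bigr => k _; rewrite mxE expr2.
by rewrite psumr_eq0 // => /allP/(_ j (mem_index_enum j)).
Qed.

Lemma mxrank_mul_tr (R : realFieldType) (p q : nat) (A : 'M[R]_(p, q)) :
  \rank (A *m A^T) = \rank A.
Proof.
(* The remaining inequality is passed to left kernels by rank-nullity. *)
apply/eqP; rewrite eqn_leq mxrankM_maxl -(leq_sub2lE _ (rank_leq_row A)).
rewrite -!mxrank_ker mxrankS //; apply/sub_kermxP/mulmx_tr_eq0.
(* For [K] the kernel matrix of [A *m A^T], the Gram matrix of [K *m A] is [K *m A *m A^T *m K^T],
   which is zero. *)
by rewrite trmx_mul !mulmxA -(mulmxA _ A) mulmx_ker mul0mx.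
Qed.

Lemma differentiable_rV (R : realType) (V : normedModType R) (q : nat)
    (f : V -> 'rV[R]_q) (p : V) :
  (forall j, differentiable (fun t => f t 0 j) p) -> differentiable f p.
Proof.
move=> df; rewrite (_ : f = \sum_(j < q) fun t => f t 0 j *: delta_mx 0 j).
  by apply: differentiable_sum => j; exact: differentiableZl.
by apply/funext => t; rewrite fct_sumE -row_sum_delta.
Qed.

Lemma smooth_at_differentiable (R : realType) (V W : normedModType R)
    (f : V -> W) (p : V) : smooth_at f p -> differentiable f p.
Proof. by case=> U [[_ Up] /(_ 1%N)[+ _]]; exact. Qed.

Section Batch.
Context {R : realType} {n : nat -> nat} {m : nat}.
Implicit Type theta : 'rV[R]_(param_dim n m).

(** Joint differentiability in parameter and input restricts to the slice [t => (t, x)]. *)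
Lemma param_smooth_differentiable theta (x : 'rV[R]_(n 0%N)) :
  param_smooth theta x ->
  differentiable (fun t => realization n m t x) theta.
Proof.
move=> /smooth_at_differentiable dF.
apply: (@differentiable_comp _ _ _ _ (fun t => (t, x)) _ theta _ dF).
exact: differentiable_pair.
Qed.

Context {theta : 'rV[R]_(param_dim n m)} {N : nat}
  {Z : N.-tuple 'rV[R]_(n 0%N)} (smoothZ : smooth_batch theta Z).

Lemma eval_map_differentiable : differentiable (eval_map Z) theta.
Proof.
apply: differentiable_rV => a.
under eq_fun do rewrite mxE.
apply: (@differentiable_comp _ _ _ _ _ (fun M : 'rV[R]_(n m) => M 0 _)).
  exact/param_smooth_differentiable/smoothZ.2/mem_tnth.
exact: differentiable_coord.
Qed.

(** The flat row index [a] encodes a pair: [tagnat.sig1 a] selects the point of the batch,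
    [tagnat.sig2 a] the output coordinate. *)
Lemma jacobian_evalE a i :
  jacobian_eval theta Z a i =
  partial_param theta (tnth Z (tagnat.sig1 a)) (tagnat.sig2 a) i.
Proof.
have dE := eval_map_differentiable.
(* Differentiability turns the differential at a basis vector into a directional derivative, which
   is then taken entrywise. *)
rewrite !mxE -deriveE // derive_mx ?mxE; last exact: diff_derivable.
by rewrite /partial_param; congr ('D_(_) _ _); apply/funext => t; rewrite mxE.
Qed.

Lemma batch_NTKE :
  batch_NTK theta Z = jacobian_eval theta Z *m (jacobian_eval theta Z)^T.
Proof.
apply/matrixP => a b; do 2!rewrite [LHS]mxE; rewrite [RHS]mxE.
by apply: eq_bigr => i _; rewrite -!jacobian_evalE; congr (_ * _); rewrite [RHS]mxE.
Qed.

Lemma rank_batch_NTK :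
  \rank (batch_NTK theta Z) = \rank (jacobian_eval theta Z).
Proof. by rewrite batch_NTKE mxrank_mul_tr. Qed.

End Batch.

Theorem theorem6p6 (R : realType) (m : nat) (n : nat -> nat)
    (hm : (0 < m)%N) (hn : forall i : nat, (i <= m)%N -> (0 < n i)%N)
    (theta : 'rV[R]_(param_dim n m)) (htheta : ordinary theta) :
  (forall (N : nat) (Z : N.-tuple 'rV[R]_(n 0%N)), smooth_batch theta Z ->
     dim_bafun theta Z = \rank (batch_NTK theta Z)) /\
  dim_fun theta =
    sup_over_batches theta (fun N Z => \rank (batch_NTK theta Z)).
Proof.
split=> [N Z smoothZ|]; first by rewrite rank_batch_NTK.
rewrite /dim_fun /sup_over_batches; congr ereal_sup.
(* Both suprema range over the same set, since the ranks agree batch by batch. *)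
apply/seteqP; split=> d [N [Z [smoothZ ->]]]; exists N, Z; split=> //.
  by rewrite rank_batch_NTK.
by rewrite rank_batch_NTK.
Qed.
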